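(* Let $n\ge m\ge 3$, let $\tau_1,\dots,\tau_k\in S_m$ be $k$ distinct permutations, let $\pi$ be a uniformly random permutation in $S_n$, and let $\mathbf{W}=(W_1,\dots,W_k)$, where $W_i$ is the number of locations $s\in\{1,\dots,n\}$ at which the pattern $\tau_i$ appears in $\pi$ (with locations taken cyclically modulo $n$). For $i=1,\dots,k$ let $$\mu_i=\frac{n}{m!},\qquad \sigma_i^2=n\left(\frac{1}{m!}\left(1-\frac{2m-1}{m!}\right)+2\sum_{j=1}^{m-1}\frac{I_j(\tau_i)}{(m+j)!}\right),$$ with $\sigma_i>0$, and let $\boldsymbol{\mu}=(\mu_1,\dots,\mu_k)$, $\boldsymbol{\sigma}=(\sigma_1,\dots,\sigma_k)$. Set $$K_1=\frac{2k(2m-1)\,m!}{m!-2m+1},\qquad K_2=\frac{\sqrt{k}\,(2m-1)\,m!}{2\sqrt{n(m!-2m+1)}}.$$ Then for any $\mathbf{t}\in\mathbb{R}^k$ with $\mathbf{t}\succeq\mathbf{0}$, $$\mathbb{P}\left(\frac{\mathbf{W}-\boldsymbol{\mu}}{\boldsymbol{\sigma}}\preceq-\mathbf{t}\right)\le\exp\left(-\frac{\|\mathbf{t}\|_2^2}{2K_1}\right)$$ and $$\mathbb{P}\left(\frac{\mathbf{W}-\boldsymbol{\mu}}{\boldsymbol{\sigma}}\succeq\mathbf{t}\right)\le\exp\left(-\frac{\|\mathbf{t}\|_2^2}{2(K_1+K_2\|\mathbf{t}\|_2)}\right).$$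
   Context: $S_m$ is the group of permutations of $\{1,\dots,m\}$. Let $\mathcal{V}=\{1,2,\dots,n\}$ and, for $s\in\mathcal{V}$, $\mathcal{V}_s=\{s,s+1,\dots,s+m-1\}$, where addition of elements of $\mathcal{V}$ is modulo $n$. The pattern $\tau\in S_m$ appears at location $s\in\mathcal{V}$ in $\pi$ if the values $\{\pi(v)\}_{v\in\mathcal{V}_s}$ and $\{\tau(v)\}_{v\in\mathcal{V}_1}$ are in the same relative order; equivalently, if $\pi(\tau^{-1}(1)+s-1)<\pi(\tau^{-1}(2)+s-1)<\dots<\pi(\tau^{-1}(m)+s-1)$, with positions read modulo $n$. For $\tau\in S_m$ and $1\le j\le m-1$, $I_j(\tau)\in\{0,1\}$ is the indicator that $\tau(1),\dots,\tau(m-j)$ and $\tau(j+1),\dots,\tau(m)$ are in the same relative order. The quantities $\mu_i$ and $\sigma_i^2$ in the statement are the expressions the paper gives (following earlier work) for the mean and variance of $W_i$. For $\mathbf{x},\mathbf{y}\in\mathbb{R}^k$, $\frac{\mathbf{x}}{\mathbf{y}}=\left(\frac{x_1}{y_1},\dots,\frac{x_k}{y_k}\right)$ is the coordinatewise quotient; $\mathbf{x}\succeq\mathbf{y}$ means $x_i\ge y_i$ for all $i$, and $\mathbf{x}\preceq\mathbf{y}$ means $\mathbf{y}\succeq\mathbf{x}$. $\|\cdot\|_2$ is the Euclidean norm on $\mathbb{R}^k$. *)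

(* Defs.v *)
From HB Require Import structures.
From mathcomp Require Import all_boot all_order all_algebra all_fingroup.
From mathcomp Require Import all_classical all_reals all_analysis.

Set Implicit Arguments.
Unset Strict Implicit.
Unset Printing Implicit Defensive.

Import Order.TTheory GRing.Theory Num.Theory.

Local Open Scope classical_set_scope.
Local Open Scope ring_scope.

(* Positions and values are indexed from 0, i.e. {1, ..., m} is 'I_m; all the
   notions below only depend on the relative order of the values. *)

Definition same_order (l : nat) (f g : 'I_l -> nat) : bool :=
  [forall a : 'I_l, forall b : 'I_l, ((f a < f b) == (g a < g b))%N].

(* [iter a (@ordS n) s] is the location s + a modulo n, so the window V_s is
   enumerated by a : 'I_m. *)
Definition appears_at (m n : nat) (tau : 'S_m) (p : 'S_n) (s : 'I_n) : bool :=
  same_order (fun a : 'I_m => p (iter a (@ordS n) s) : nat)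
             (fun a : 'I_m => tau a : nat).

Definition pattern_count (m n : nat) (tau : 'S_m) (p : 'S_n) : nat :=
  #|[pred s : 'I_n | appears_at tau p s]|.

Fact shift_ord_subproof (m j : nat) (a : 'I_(m - j)) : (j + a < m)%N.
Proof. by rewrite -ltn_subRL. Qed.

Definition shift_ord (m j : nat) (a : 'I_(m - j)) : 'I_m :=
  Ordinal (shift_ord_subproof a).

(* I_j(tau), as a boolean. *)
Definition self_overlap (m : nat) (tau : 'S_m) (j : nat) : bool :=
  same_order (fun a : 'I_(m - j) => tau (widen_ord (leq_subr j m) a) : nat)
             (fun a : 'I_(m - j) => tau (shift_ord a) : nat).

Section Vectors.
Variables (R : realType) (k : nat).
Implicit Types x y : 'rV[R]_k.

Definition coord_div x y : 'rV[R]_k := \row_i (x 0 i / y 0 i).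

Definition coord_le x y : Prop := forall i, x 0 i <= y 0 i.

(* The library norm on matrices is the sup norm, hence this definition. *)
Definition norm2 x : R := Num.sqrt (\sum_i x 0 i ^+ 2).

End Vectors.

Section PatternVectors.
Variables (R : realType) (n m k : nat) (tau : 'I_k -> 'S_m).

Definition Wvec (p : 'S_n) : 'rV[R]_k := \row_i (pattern_count (tau i) p)%:R.

Definition mu_vec : 'rV[R]_k := \row_(_ < k) (n%:R / m`!%:R).

Definition sigma2 (i : 'I_k) : R :=
  n%:R * (m`!%:R^-1 * (1 - (2 * m%:R - 1) / m`!%:R)
          + 2 * \sum_(1 <= j < m) (self_overlap (tau i) j)%:R / (m + j)`!%:R).

Definition sigma_vec : 'rV[R]_k := \row_i Num.sqrt (sigma2 i).

Definition K1 : R :=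
  2 * k%:R * (2 * m%:R - 1) * m`!%:R / (m`!%:R - 2 * m%:R + 1).

Definition K2 : R :=
  Num.sqrt k%:R * (2 * m%:R - 1) * m`!%:R
  / (2 * Num.sqrt (n%:R * (m`!%:R - 2 * m%:R + 1))).

End PatternVectors.

Arguments Wvec R {n m k} tau p.
Arguments mu_vec R n m k : clear implicits.
Arguments sigma_vec R n {m k} tau.
Arguments K1 R m k : clear implicits.
Arguments K2 R n m k : clear implicits.

(* X is a measurable map with the uniform law on the finite set 'S_n. *)
Definition uniform_perm (d : measure_display) (T : measurableType d)
    (R : realType) (P : probability T R) (n : nat) (X : T -> 'S_n) : Prop :=
  forall p : 'S_n,
    measurable (X @^-1` [set p]) /\ P (X @^-1` [set p]) = (n`!%:R^-1)%:E.

(* Main.v *)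
(** The multivariate bound reduces to a scalar one: on either event, pairing the
    standardized vector with [t] shows that the weighted count
    [Y = \sum_i (t_i / sigma_i) W_i] deviates from its mean [mu] by at least
    [|t|^2].

    Permuting the entries of [p] at the positions of one window changes [Y] by
    at most [D = (2m-1) \sum_i t_i / sigma_i], since at most [2m-1] windows meet
    a given one, and exactly one of these [m!] rearrangements makes a given
    pattern appear there. Averaging over them gives
    [E[Y e^(lY)] <= mu e^(lD) E[e^(lY)]] for [l >= 0], and the reverse
    inequality for [l <= 0]. Integrating this differential inequality for the
    moment generating function yields
    [log E[e^(l(Y-mu))] <= (mu/D) (e^(lD) - 1 - lD)] for every [l], from which
    both tails follow by Chernoff's method. Finally [sigma_i^2] is bounded below
    by dropping its overlap terms, and Cauchy-Schwarz bounds [\sum_i t_i] by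
    [sqrt k |t|]. *)
Require Import Defs.
From HB Require Import structures.
From mathcomp Require Import all_boot all_order all_algebra all_fingroup.
From mathcomp Require Import all_classical all_reals all_analysis.
From mathcomp Require Import zify ring lra.

Set Implicit Arguments.
Unset Strict Implicit.
Unset Printing Implicit Defensive.

Import Order.TTheory GRing.Theory Num.Theory.
Import numFieldNormedType.Exports.

Local Open Scope ring_scope.

(** * Tail bounds from a size-bias inequality *)

Lemma is_derive_ge0_le (R : realType) (f f' : R -> R) (a b : R) :
  (forall x : R, is_derive x 1 f (f' x)) ->
  (forall x, a < x < b -> 0 <= f' x) -> a <= b -> f a <= f b.
Proof.
move=> df f'_ge0 ab; have dfx x : derivable f (x : R) 1 by exact: ex_derive.
apply: (@ger0_derive1_ndecr _ f a b) => //.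
- by move=> x; rewrite in_itv/= derive1E derive_val; exact: f'_ge0.
- by apply: continuous_subspaceT => x; exact/differentiable_continuous/derivable1_diffP.
Qed.

Lemma is_derive_bigsum (R : realType) (I : Type) (r : seq I)
    (f f' : I -> R -> R) (x : R) :
  (forall i, is_derive x 1 (f i) (f' i x)) ->
  is_derive x 1 (fun y => \sum_(i <- r) f i y) (\sum_(i <- r) f' i x).
Proof.
move=> df; elim: r => [|i r IHr].
  under eq_fun do rewrite big_nil.
  by rewrite big_nil; exact: is_derive_cst.
under eq_fun do rewrite big_cons.
by rewrite big_cons; exact: is_deriveD.
Qed.

Lemma expR_le_quad (R : realType) (u : R) :
  u <= 0 -> expR u <= 1 + u + u ^+ 2 / 2.
Proof.
move=> u_le0; rewrite -subr_ge0.
pose f (v : R) := expR v - (1 + v + v ^+ 2 / 2).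
suff : f u <= f 0 by rewrite /f expR0 expr0n /=; lra.
apply: (@is_derive_ge0_le _ f (fun v => expR v - (1 + v))) => // [x|x _].
  apply: is_derive_eq; rewrite /GRing.scale/=; lra.
by rewrite subr_ge0 expR_ge1Dx.
Qed.

(** The bound is the (1,1) Pade approximant of the exponential. Minus [1 + u] it equals
    [u^2 / (2 - u)], which gives the upper tail its Bernstein-type denominator. *)
Lemma expR_le_pade (R : realType) (u : R) :
  0 <= u < 2 -> expR u <= (2 + u) / (2 - u).
Proof.
move=> /andP[u_ge0 u_lt2].
(* Splitting the exponential evenly between both sides yields a derivative of evident sign. *)
pose f (v : R) := (2 + v) * expR (- v / 2) - (2 - v) * expR (v / 2).
have fu : 0 <= f u.
  have -> : 0 = f 0 by rewrite /f mul0r oppr0 mul0r expR0; ring.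
  apply: (@is_derive_ge0_le _ f
    (fun v => v / 2 * (expR (v / 2) - expR (- v / 2)))) => // [x|x /andP[x0 _]].
    apply: is_derive_eq; rewrite /GRing.scale/=; by field.
  by apply: mulr_ge0; [lra | rewrite subr_ge0 ler_expR; lra].
rewrite ler_pdivlMr; last lra.
have E1 : expR (- u / 2) * expR (u / 2) = 1.
  by rewrite -expRD (_ : - u / 2 + u / 2 = 0) ?expR0//; lra.
have E2 : expR (u / 2) * expR (u / 2) = expR u.
  by rewrite -expRD (_ : u / 2 + u / 2 = u)//; lra.
rewrite -subr_ge0; have := mulr_ge0 fu (expR_ge0 (u / 2)).
by rewrite /f mulrBl -!mulrA E1 E2 mulr1 [expR u * _]mulrC.
Qed.

Section SizeBiasConcentration.
Variables (R : realType) (I : finType) (Y : I -> R) (mu D : R).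
Hypotheses (mu_gt0 : 0 < mu) (D_gt0 : 0 < D).
Hypothesis bias_up : forall l : R, 0 <= l ->
  \sum_p Y p * expR (l * Y p) <= mu * expR (l * D) * \sum_p expR (l * Y p).
Hypothesis bias_down : forall l : R, l <= 0 ->
  mu * expR (l * D) * \sum_p expR (l * Y p) <= \sum_p Y p * expR (l * Y p).

(** By the two bias hypotheses, the normalized sum [H] is nondecreasing on the negative axis and
    nonincreasing on the positive one, so it is largest at 0, where it equals [#|I|]. *)
Lemma mgf_le (l : R) :
  \sum_p expR (l * (Y p - mu)) <=
  #|I|%:R * expR (mu / D * (expR (l * D) - 1 - l * D)).
Proof.
(* This is the primitive of [mu * expR (x * D)] that vanishes at 0. *)
pose c (x : R) := mu / D * (expR (x * D) - 1).
pose H (x : R) := \sum_p expR (x * Y p - c x).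
pose H' (x : R) := \sum_p expR (x * Y p - c x) * (Y p - mu * expR (x * D)).
have dH (x : R) : is_derive x 1 H (H' x).
  apply: (@is_derive_bigsum _ _ _ (fun p x => expR (x * Y p - c x))
    (fun p x => expR (x * Y p - c x) * (Y p - mu * expR (x * D)))) => p.
  rewrite /c.
  apply: is_derive_eq; rewrite /GRing.scale/=; field; exact: lt0r_neq0.
have H'E x : H' x = expR (- c x) * (\sum_p Y p * expR (x * Y p) -
                       mu * expR (x * D) * \sum_p expR (x * Y p)).
  rewrite mulrBr !mulr_sumr -sumrB; apply: eq_bigr => p _.
  by rewrite expRD; ring.
have H0 : H 0 = #|I|%:R.
  rewrite /H /c mul0r expR0 subrr mulr0 -sum1_card natr_sum.
  by apply: eq_bigr => p _; rewrite mul0r subr0 expR0.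
have HH0 : H l <= #|I|%:R.
  rewrite -H0; case: (leP 0 l) => l0.
    suff : - H 0 <= - H l by rewrite lerN2.
    apply: (@is_derive_ge0_le _ (fun x => - H x) (fun x => - H' x)) => // x /andP[x0 _].
    by rewrite H'E -mulrN mulr_ge0 ?expR_ge0// opprB subr_ge0 bias_up ?ltW.
  apply: (@is_derive_ge0_le _ H H') => //; last exact: ltW.
  by move=> x /andP[_ x0]; rewrite H'E mulr_ge0 ?expR_ge0// subr_ge0 bias_down ?ltW.
apply: le_trans (ler_wpM2r (expR_ge0 _) HH0).
rewrite /H mulr_suml le_eqVlt; apply/orP; left; apply/eqP.
apply: eq_bigr => p _; rewrite -expRD; congr expR.
rewrite /c; field; exact: lt0r_neq0.
Qed.

(** Exponential Markov inequality in counting form. A negative [l] handles the lower tail, a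
    positive one the upper tail. *)
Lemma chernoff (l x : R) (A : pred I) :
  (forall p, A p -> l * x <= l * (Y p - mu)) ->
  #|A|%:R <= #|I|%:R * expR (mu / D * (expR (l * D) - 1 - l * D) - l * x).
Proof.
move=> Ax; rewrite [expR _]expRD mulrA expRN -[X in X <= _]mul1r.
rewrite ler_pdivlMr ?expR_gt0// mul1r (le_trans _ (mgf_le l))//.
rewrite -sum1_card natr_sum mulr_suml big_mkcond/= ler_sum// => p _.
case: ifP => [Ap|_]; last exact: expR_ge0.
by rewrite mul1r ler_expR Ax.
Qed.

Lemma size_bias_lower_tail (x : R) : 0 <= x ->
  #|[pred p | Y p - mu <= - x]|%:R
  <= #|I|%:R * expR (- (x ^+ 2 / (2 * (mu * D)))).
Proof.
move=> x_ge0; have muD_gt0 : 0 < mu * D by rewrite mulr_gt0.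
(* Minimizer of [mu * D * l^2 / 2 + l * x], the exponent left after [expR_le_quad]. *)
pose l := - (x / (mu * D)).
have l_le0 : l <= 0 by rewrite oppr_le0 divr_ge0 ?(ltW muD_gt0).
apply: le_trans (chernoff (l := l) (x := - x) _) _.
  by move=> p /= Yp; rewrite ler_wnM2l.
rewrite ler_wpM2l// ler_expR.
have lD_le0 : l * D <= 0 by rewrite mulr_le0_ge0 ?(ltW D_gt0).
have [D0 mu0] := (lt0r_neq0 D_gt0, lt0r_neq0 mu_gt0).
have -> : - (x ^+ 2 / (2 * (mu * D))) = mu / D * ((l * D) ^+ 2 / 2) - l * - x.
  by rewrite /l; field; rewrite D0 mu0.
rewrite lerD2r ler_wpM2l ?divr_ge0 ?(ltW mu_gt0) ?(ltW D_gt0)//.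
by move: (l * D) lD_le0 => u u_le0; have := expR_le_quad u_le0; lra.
Qed.

Lemma size_bias_upper_tail (x : R) : 0 <= x ->
  #|[pred p | x <= Y p - mu]|%:R
  <= #|I|%:R * expR (- (x ^+ 2 / (2 * (mu * D) + D * x))).
Proof.
move=> x_ge0; have muD_gt0 : 0 < mu * D by rewrite mulr_gt0.
have Dx_ge0 : 0 <= D * x by rewrite mulr_ge0// ltW.
have B_gt0 : 0 < 2 * (mu * D) + D * x by lra.
(* After [expR_le_pade] the exponent is [mu * D * l^2 / (2 - l * D) - l * x]; this [l] makes it
   exactly [- x^2 / (2 * mu * D + D * x)]. *)
pose l := 2 * x / (2 * (mu * D) + D * x).
have l_ge0 : 0 <= l by rewrite divr_ge0 ?mulr_ge0// ltW.
apply: le_trans (chernoff (l := l) (x := x) _) _.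
  by move=> p /= Yp; rewrite ler_wpM2l.
rewrite ler_wpM2l// ler_expR.
have [D0 mu0] := (lt0r_neq0 D_gt0, lt0r_neq0 mu_gt0).
have B0 := lt0r_neq0 B_gt0.
have lDE : 2 - l * D = 4 * (mu * D) / (2 * (mu * D) + D * x).
  by rewrite /l; field.
have lD_lt2 : 0 < 2 - l * D by rewrite lDE divr_gt0// mulr_gt0.
have lD : 0 <= l * D < 2 by rewrite (mulr_ge0 l_ge0 (ltW D_gt0)) -subr_gt0.
have -> : - (x ^+ 2 / (2 * (mu * D) + D * x))
    = mu / D * ((2 + l * D) / (2 - l * D) - 1 - l * D) - l * x.
  rewrite lDE /l; field; rewrite B0 D0 mu0 //.
rewrite lerD2r ler_wpM2l ?divr_ge0 ?(ltW mu_gt0) ?(ltW D_gt0)//.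
by move: (l * D) lD => u lD; have := expR_le_pade lD; lra.
Qed.

End SizeBiasConcentration.

(** * Rearranging the entries in a window *)

Section PatternsInWindows.
Variables (m n : nat).
Hypothesis le_mn : (m <= n)%N.

Definition window (s : 'I_n) (a : 'I_m) : 'I_n := iter a (@ordS n) s.

Lemma val_iter_ordS (a : nat) (s : 'I_n) :
  iter a (@ordS n) s = ((s + a) %% n)%N :> nat.
Proof.
elim: a => [|a IHa] /=; first by rewrite addn0 modn_small.
by rewrite IHa -addn1 modnDml addn1 addnS.
Qed.

Lemma window_inj (s : 'I_n) : injective (window s).
Proof.
move=> a b /(congr1 val); rewrite /= !val_iter_ordS => /eqP.
rewrite eqn_modDl !modn_small; last 2 first.
- exact: leq_trans (ltn_ord b) le_mn.
- exact: leq_trans (ltn_ord a) le_mn.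
by move/eqP/val_inj.
Qed.

Definition window_set (s : 'I_n) : {set 'I_n} := [set window s a | a : 'I_m].

Lemma card_window_set (s : 'I_n) : #|window_set s| = m.
Proof. by rewrite card_imset ?card_ord//; exact: window_inj. Qed.

Lemma card_meeting_windows (s : 'I_n) :
  (#|[set r | ~~ [disjoint window_set r & window_set s]]| <= 2 * m - 1)%N.
Proof.
(* [F] runs through [2m - 1] consecutive locations, from [m - 1] before [s] to [m - 1] after it. It
   may repeat values when [2m - 1 > n], but only the size of its image has to be bounded. *)
pose s' := iter m.-1 (@ord_pred n) s.
pose F (c : 'I_(2 * m - 1)) := iter c (@ordS n) s'.
have s'K b : iter (b + m.-1) (@ordS n) s' = iter b (@ordS n) s.
  rewrite iterD; congr iter; rewrite /s'.
  by elim: (m.-1) => // k IHk; rewrite iterSr iterS ord_predK.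
apply: (@leq_trans #|F @: [set: _]|); last first.
  by rewrite (leq_trans (leq_imset_card _ _))// cardsT card_ord.
apply/subset_leq_card/fintype.subsetP => r; rewrite inE => /pred0Pn[v /=].
case/andP => /imsetP[a _ ->] /imsetP[b _ ab].
(* A position that is [a] steps after [r] and [b] steps after [s] places [r] at [b + (m - 1) - a]
   steps after [s']. *)
have lt_c : (b + m.-1 - a < 2 * m - 1)%N by have := ltn_ord a; have := ltn_ord b; lia.
apply/imsetP; exists (Ordinal lt_c) => //.
have iter_inj : injective (iter a (@ordS n)).
  by elim: (val a) => [//|k IHk] x y /= /ordS_inj/IHk.
apply: iter_inj; rewrite /F /= -iterD subnKC ?s'K//.
by have := ltn_ord a; lia.
Qed.

(** The left factor of a product acts first, so [q * p] is [p] with its entries rearranged among the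
    positions that [q] moves, all of them in the window of [s]. *)
Lemma appears_at_outside (tau : 'S_m) (p q : 'S_n) (s r : 'I_n) :
  perm_on (window_set s) q -> [disjoint window_set r & window_set s] ->
  appears_at tau (q * p)%g r = appears_at tau p r.
Proof.
move=> qs rs; rewrite /appears_at /same_order.
have qE (a : 'I_m) : (q * p)%g (iter a (@ordS n) r) = p (iter a (@ordS n) r).
  rewrite permM (out_perm qs)//.
  by rewrite (disjointFr rs)//; apply/imsetP; exists a.
by apply: eq_forallb => a; apply: eq_forallb => b; rewrite !qE.
Qed.

(** Every occurrence created by [q] sits at a location whose window meets that of [s]. *)
Lemma pattern_count_mul (tau : 'S_m) (p q : 'S_n) (s : 'I_n) :
  perm_on (window_set s) q ->
  (pattern_count tau (q * p)%g <= pattern_count tau p + (2 * m - 1))%N.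
Proof.
move=> qs; rewrite /pattern_count -[X in (X <= _)%N]cardsE -[X in (_ <= X + _)%N]cardsE.
apply: leq_trans (leq_add (leqnn _) (card_meeting_windows s)).
apply: leq_trans (leq_card_setU _ _).
apply/subset_leq_card/fintype.subsetP => r; rewrite !inE.
case: (boolP [disjoint _ & _]) => [rs|_ _]; last by rewrite orbT.
by rewrite (appears_at_outside _ _ qs rs) => ->.
Qed.

(** For injective [f] this is the standardization of [f], counted from 0: the permutation with the
    same relative order. *)
Definition rank (l : nat) (f : 'I_l -> nat) (a : 'I_l) : nat :=
  #|[set b | (f b < f a)%N]|.

Lemma rank_lt (l : nat) (f : 'I_l -> nat) (a : 'I_l) : (rank f a < l)%N.
Proof.
rewrite /rank -[X in (_ < X)%N]card_ord -cardsT; apply: proper_card.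
by apply/properP; split; [exact: finset.subsetT | exists a; rewrite ?inE ?ltnn].
Qed.

Lemma ltn_rank (l : nat) (f : 'I_l -> nat) (a b : 'I_l) :
  (rank f a < rank f b)%N = (f a < f b)%N.
Proof.
apply/idP/idP => [|ab]; first rewrite !ltnNge; first apply: contra => ba.
  apply/subset_leq_card/fintype.subsetP => c; rewrite !inE => cb.
  exact: leq_trans cb ba.
apply/proper_card/properP; split; last by exists a; rewrite inE ?ltnn.
by apply/fintype.subsetP => c; rewrite !inE => /ltn_trans; apply.
Qed.

Lemma rank_perm (tau : 'S_m) (a : 'I_m) :
  rank (fun b => tau b : nat) a = tau a.
Proof.
rewrite /rank (_ : [set b | _] = tau @^-1: [set c : 'I_m | (c < tau a)%N]).
  rewrite card_preimset; last exact: perm_inj.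
  by rewrite -sum1dep_card (big_ord_narrow (ltnW (ltn_ord _))) sum1_card card_ord.
by apply/setP => b; rewrite !inE.
Qed.

Lemma same_order_rank (l : nat) (f g : 'I_l -> nat) :
  same_order f g <-> rank f =1 rank g.
Proof.
split=> [/forallP fg a|fg].
  apply: eq_card => b; rewrite !inE.
  by have /forallP/(_ a)/eqP := fg b.
by apply/forallP => a; apply/forallP => b; rewrite -(ltn_rank f) -(ltn_rank g) !fg.
Qed.

(** Since [q] maps the window onto itself, the values compared are those of [p] on the window,
    whatever [q] is; only the threshold depends on [q]. *)
Lemma rank_window (p q : 'S_n) (s : 'I_n) (a : 'I_m) :
  perm_on (window_set s) q ->
  rank (fun b => (q * p)%g (window s b) : nat) a =
  #|[set v in window_set s | (p v < p (q (window s a)))%N]|.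
Proof.
move=> qs; pose h b := q (window s b).
have h_inj : injective h by move=> b c /perm_inj/window_inj.
rewrite /rank -(card_imset _ h_inj); apply: eq_card => v; rewrite !inE.
apply/imsetP/andP => [[b + ->]|[]].
  by rewrite inE !permM perm_closed// => ?; split=> //; apply/imsetP; exists b.
rewrite -(im_perm_on qs) => /imsetP[u /imsetP[b _ ->] ->] lt_p.
by exists b => //; rewrite inE !permM.
Qed.

Lemma rank_window_inj (p q q' : 'S_n) (s : 'I_n) :
  perm_on (window_set s) q -> perm_on (window_set s) q' ->
  rank (fun b => (q * p)%g (window s b) : nat) =1
  rank (fun b => (q' * p)%g (window s b) : nat) ->
  q = q'.
Proof.
move=> qs q's rqq'; apply/permP => v.
have [|vs] := boolP (v \in window_set s); last by rewrite !(out_perm _ vs).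
case/imsetP => a _ ->; have := rqq' a; rewrite !rank_window// => /eqP cardE.
have ws : window s a \in window_set s by apply/imsetP; exists a.
apply: (@perm_inj _ p); apply: val_inj; apply/eqP; rewrite eqn_leq.
rewrite -[X in _ && X]negbK -ltnNge -[X in X && _]negbK -ltnNge -negb_or.
apply: contraTN cardE; rewrite neq_ltn => /orP[lt_p|lt_p]; apply/orP; [right|left].
all: apply/proper_card/properP; split;
  first by apply/fintype.subsetP => u; rewrite !inE => /andP[-> /ltn_trans]; exact.
(* Strictness is witnessed by the position of the smaller value, which is counted below the larger
   value but not below itself. *)
all: [> exists (q' (window s a)) | exists (q (window s a)) ];
  by rewrite !inE perm_closed// ws ?lt_p ?ltnn.
Qed.

Lemma rank_inj (l : nat) (f : 'I_l -> nat) :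
  injective f -> injective (fun a => Ordinal (rank_lt f a)).
Proof.
move=> f_inj a b /(congr1 val)/= ab; apply: f_inj.
by case: (ltngtP (f a) (f b)) => //; rewrite -ltn_rank ab ltnn.
Qed.

(** Standardizing the window is injective on the [m!] permutations supported there, hence a
    bijection onto ['S_m] by counting; each pattern has exactly one preimage. *)
Lemma card_rearrangements (tau : 'S_m) (p : 'S_n) (s : 'I_n) :
  #|[set q | perm_on (window_set s) q & appears_at tau (q * p)%g s]| = 1%N.
Proof.
have f_inj (q : 'S_n) : injective (fun b => (q * p)%g (window s b) : nat).
  by move=> a b /val_inj/perm_inj/window_inj.
pose std q : 'S_m := perm (rank_inj (f_inj q)).
pose Q : {set 'S_n} := [set q | perm_on (window_set s) q].
have stdE q a : std q a = rank (fun b => (q * p)%g (window s b) : nat) a :> nat.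
  by rewrite permE.
have std_inj : {in Q &, injective std}.
  move=> q q'; rewrite !inE => qs q's qq'; apply: (rank_window_inj (p := p) qs q's).
  by move=> a; rewrite -!stdE qq'.
have stdP q : appears_at tau (q * p)%g s = (std q == tau).
  apply/idP/eqP => [/same_order_rank rE|<-].
    by apply/permP => a; apply: val_inj; rewrite /= stdE -rank_perm -rE.
  by apply/same_order_rank => a; rewrite rank_perm stdE.
have : tau \in std @: Q.
  suff -> : std @: Q = [set: _] by rewrite inE.
  apply/eqP; rewrite eqEcard finset.subsetT/= card_in_imset// cardsT card_Sn.
  by rewrite cardsE card_perm card_window_set.
case/imsetP => q0 Qq0 tauE; apply/eqP/cards1P; exists q0; apply/setP => q.
rewrite !inE stdP tauE; apply/andP/eqP => [[qs /eqP stdq]|->].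
  by apply: std_inj => //; rewrite inE.
by move: Qq0; rewrite inE.
Qed.

End PatternsInWindows.

(** * Size-bias inequalities for weighted pattern counts *)

Section SizeBias.
Variables (R : realType) (m n k : nat) (tau : 'I_k -> 'S_m) (a : 'I_k -> R).
Hypotheses (le_mn : (m <= n)%N) (a_ge0 : forall i, 0 <= a i).

Definition weighted_count (p : 'S_n) : R :=
  \sum_i a i * (pattern_count (tau i) p)%:R.

Lemma weighted_count_mul (p q : 'S_n) (s : 'I_n) :
  perm_on (window_set m s) q ->
  weighted_count (q * p)%g <= weighted_count p + (2 * m - 1)%:R * \sum_i a i.
Proof.
move=> qs; rewrite mulr_sumr -big_split/= ler_sum// => i _.
rewrite [_ * a i]mulrC -mulrDr ler_wpM2l// -natrD ler_nat.
exact: (pattern_count_mul _ _ _ qs).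
Qed.

(* Averaging over the m! permutations [q] of the positions in a window: exactly
   one of them makes [sigma] appear there. *)
Lemma sum_appears_at_le (F : 'S_n -> R) (c : R) (s : 'I_n) (sigma : 'S_m) :
  (forall p q, perm_on (window_set m s) q -> F (q * p)%g <= c * F p) ->
  \sum_p (appears_at sigma p s)%:R * F p <= m`!%:R^-1 * (c * \sum_p F p).
Proof.
move=> Fc; rewrite ler_pdivlMl ?ltr0n ?fact_gt0//.
have -> : m`!%:R = \sum_(q | perm_on (window_set m s) q) 1 :> R.
  by rewrite sumr_const card_perm card_window_set.
(* For fixed [q], translating [p] to [q * p] permutes ['S_n] and preserves the sum. *)
rewrite mulr_suml (eq_bigr (fun q =>
  \sum_p (appears_at sigma (q * p)%g s)%:R * F (q * p)%g)); last first.
  by move=> q _; rewrite mul1r (reindex_inj (mulgI q)).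
rewrite exchange_big mulr_sumr/= ler_sum// => p _.
apply: (@le_trans _ _ (\sum_(q | perm_on (window_set m s) q)
    (appears_at sigma (q * p)%g s)%:R * (c * F p))).
  by apply: ler_sum => q qs; rewrite ler_wpM2l ?ler0n ?Fc.
rewrite -mulr_suml -natr_sum -big_mkcondr/= sum1dep_card.
by rewrite card_rearrangements// mul1r.
Qed.

(** [F] may have either sign: the exponential of [l * weighted_count] gives the upper inequality,
    and its negative gives the reverse one. *)
Lemma sum_weighted_count_le (F : 'S_n -> R) (c : R) :
  (forall p q s, perm_on (window_set m s) q -> F (q * p)%g <= c * F p) ->
  \sum_p weighted_count p * F p
  <= n%:R / m`!%:R * (\sum_i a i) * c * \sum_p F p.
Proof.
move=> Fc.
have -> : \sum_p weighted_count p * F p =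
    \sum_i a i * \sum_s \sum_p (appears_at (tau i) p s)%:R * F p.
  under [RHS]eq_bigr do rewrite exchange_big mulr_sumr.
  rewrite [RHS]exchange_big; apply: eq_bigr => p _.
  rewrite mulr_suml; apply: eq_bigr => i _.
  rewrite -mulrA -mulr_suml; congr (_ * (_ * _)).
  by rewrite /pattern_count -sum1_card big_mkcond natr_sum.
have -> : n%:R / m`!%:R * (\sum_i a i) * c * \sum_p F p =
    \sum_i a i * \sum_(s < n) m`!%:R^-1 * (c * \sum_p F p).
  rewrite -mulr_suml sumr_const card_ord -mulr_natl; ring.
apply: ler_sum => i _; rewrite ler_wpM2l// ler_sum// => s _.
by apply: sum_appears_at_le => p q; exact: Fc.
Qed.

Let mu := n%:R / m`!%:R * \sum_i a i.
Let D := (2 * m - 1)%:R * \sum_i a i.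

Lemma weighted_count_bias_up (l : R) : 0 <= l ->
  \sum_p weighted_count p * expR (l * weighted_count p)
  <= mu * expR (l * D) * \sum_p expR (l * weighted_count p).
Proof.
move=> l_ge0; apply: sum_weighted_count_le => p q s qs.
by rewrite -expRD ler_expR -mulrDr ler_wpM2l// addrC (weighted_count_mul _ qs).
Qed.

Lemma weighted_count_bias_down (l : R) : l <= 0 ->
  mu * expR (l * D) * \sum_p expR (l * weighted_count p)
  <= \sum_p weighted_count p * expR (l * weighted_count p).
Proof.
move=> l_le0.
rewrite -lerN2 -mulrN -!sumrN; under eq_bigr do rewrite -mulrN.
apply: sum_weighted_count_le => p q s qs.
rewrite mulrN lerN2 -expRD ler_expR -mulrDr ler_wnM2l// addrC.
exact: (weighted_count_mul _ qs).
Qed.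

End SizeBias.

(** * Elementary inequalities and passage from counting to probability *)

Lemma sqr_sum_le (R : realType) (k : nat) (x : 'I_k -> R) :
  (\sum_i x i) ^+ 2 <= k%:R * \sum_i x i ^+ 2.
Proof.
case: k x => [x|{}k x]; first by rewrite !big_ord0 expr0n mul0r.
set S := \sum_i x i; set Q := \sum_i _.
(* Cauchy-Schwarz in variance form: the squared deviations from the mean sum to [Q - S^2 / k]. *)
have : 0 <= \sum_i (x i - S / k.+1%:R) ^+ 2.
  by apply: sumr_ge0 => i _; exact: sqr_ge0.
have -> : \sum_i (x i - S / k.+1%:R) ^+ 2 = Q - S ^+ 2 / k.+1%:R.
  under eq_bigr do rewrite sqrrB.
  rewrite big_split/= sumrB sumrMnl -mulr_suml -/S -/Q sumr_const card_ord.
  have : k.+1%:R != 0 :> R by rewrite pnatr_eq0.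
  by rewrite -[(S / _) ^+ 2 *+ _]mulr_natl; move: k.+1%:R => K K0; field.
by rewrite subr_ge0 ler_pdivrMr ?ltr0n// mulrC.
Qed.

(** Makes [m! - 2m + 1], the denominator in [K1] and [K2], positive. *)
Lemma double_le_fact (m : nat) : (3 <= m)%N -> (2 * m <= m`!)%N.
Proof.
case: m => [|[|[|m]]] // _; rewrite factS mulnC leq_pmul2l//.
by rewrite factS (@leq_trans m.+2)// leq_pmulr ?fact_gt0.
Qed.

Local Open Scope classical_set_scope.
Local Open Scope ring_scope.

(** The event is a finite union of fibres of [X], each of mass [1 / n!], so subadditivity reduces
    the bound to counting. *)
Lemma uniform_perm_le (R : realType) (n : nat) (d : measure_display)
    (T : measurableType d) (P : probability T R) (X : T -> 'S_n)
    (E : 'S_n -> Prop) (A : pred 'S_n) (c : R) :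
  uniform_perm P X -> (forall p, E p -> A p) -> #|A|%:R <= n`!%:R * c ->
  (P [set w | E (X w)] <= c%:E)%E.
Proof.
move=> hX EA Ac.
pose U (r : seq 'S_n) := \big[setU/set0]_(p <- r | `[<E p>]) (X @^-1` [set p]).
have mU r : measurable (U r).
  by apply: bigsetU_measurable => p _; exact: (hX p).1.
have PU r : (P (U r) <= (\sum_(p <- r | `[<E p>]) n`!%:R^-1)%:E)%E.
  rewrite /U; elim: r => [|p r IHr]; first by rewrite !big_nil measure0.
  rewrite !big_cons; case: ifP => // _.
  apply: le_trans (measureU2 _ _ _) _; [exact: (hX p).1|exact: mU|].
  by rewrite EFinD; apply: leeD => //; rewrite -(hX p).2.
have -> : [set w | E (X w)] = U (index_enum _).
  rewrite /U -bigcup_seq_cond; apply/seteqP; split=> [w Ew|w [p]] /=.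
    by exists (X w) => //=; rewrite mem_index_enum; exact/asboolP.
  by move=> /andP[_ /asboolP Ep] ->.
apply: le_trans (PU _) _; rewrite lee_fin big_const_seq iter_addr_0.
rewrite -[X in X <= _]mulr_natl ler_pdivrMr ?ltr0n ?fact_gt0// mulrC (le_trans _ Ac)//.
rewrite ler_nat -sum1_count sum1_card subset_leq_card//.
by apply/fintype.subsetP => p; rewrite !unfold_in => /asboolP/EA.
Qed.

(** * Multivariate tails from the scalar ones *)

Theorem theorem4p2 (R : realType) (n m k : nat)
    (hm : (3 <= m)%N) (hn : (m <= n)%N) (hk : (0 < k)%N)
    (tau : 'I_k -> 'S_m) (tau_inj : injective tau)
    (d : measure_display) (T : measurableType d) (P : probability T R)
    (X : T -> 'S_n) (hX : uniform_perm P X)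
    (t : 'rV[R]_k) (ht : coord_le 0 t) :
  (P [set w | coord_le
                (coord_div (Wvec R tau (X w) - mu_vec R n m k)
                           (sigma_vec R n tau))
                (- t)]
   <= (expR (- (norm2 t ^+ 2 / (2 * K1 R m k))))%:E)%E
  /\
  (P [set w | coord_le t
                (coord_div (Wvec R tau (X w) - mu_vec R n m k)
                           (sigma_vec R n tau))]
   <= (expR (- (norm2 t ^+ 2
                / (2 * (K1 R m k + K2 R n m k * norm2 t)))))%:E)%E.
Proof.
have t_ge0 i : 0 <= t 0 i by have := ht i; rewrite mxE.
pose Z (p : 'S_n) := coord_div (Wvec R tau p - mu_vec R n m k) (sigma_vec R n tau).
set N := norm2 t; have N_ge0 : 0 <= N by exact: sqrtr_ge0.
have N2 : N ^+ 2 = \sum_i t 0 i ^+ 2.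
  by rewrite sqr_sqrtr//; apply: sumr_ge0 => i _; exact: sqr_ge0.
(* For [t = 0] both bounds equal 1. Otherwise [A], [mu] and [D] are positive, as the scalar tail
   bounds require. *)
have [N0|N_neq0] := eqVneq N 0.
  rewrite N0 expr0n/= !mul0r oppr0 expR0.
  have cardT : #|(xpredT : pred 'S_n)|%:R <= n`!%:R * 1 :> R.
    by rewrite mulr1 ler_nat -card_Sn.
  by split; [apply: (uniform_perm_le (E := fun p => coord_le (Z p) (- t)) hX _ cardT)
            |apply: (uniform_perm_le (E := fun p => coord_le t (Z p)) hX _ cardT)].
have N_gt0 : 0 < N by rewrite lt0r N_neq0.
pose M : R := m`!%:R; pose r := M - 2 * m%:R + 1.
pose b : R := 2 * m%:R - 1.
have M_gt0 : 0 < M by rewrite ltr0n fact_gt0.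
have r_gt0 : 0 < r.
  have : 2 * m%:R <= M by rewrite -natrM ler_nat double_le_fact.
  rewrite /r; lra.
have b_gt0 : 0 < b.
  rewrite /b; have : 3 <= m%:R :> R by rewrite ler_nat.
  lra.
have bE : (2 * m - 1)%:R = b by rewrite natrB ?natrM//; lia.
have n_gt0 : 0 < n%:R :> R by rewrite ltr0n; lia.
have k_gt0 : 0 < k%:R :> R by rewrite ltr0n.
pose q : R := Num.sqrt (n%:R * r).
have q_gt0 : 0 < q by rewrite sqrtr_gt0 mulr_gt0.
have q2 : q ^+ 2 = n%:R * r by rewrite sqr_sqrtr// ltW// mulr_gt0.
pose sg i : R := sigma_vec R n tau 0 i.
(* [q / M] is the value of [sigma_i] without its overlap terms. *)
have sg_ge i : q / M <= sg i.
  have -> : q / M = Num.sqrt ((q / M) ^+ 2).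
    by rewrite sqrtr_sqr ger0_norm// divr_ge0 ?ltW.
  rewrite /sg mxE ler_wsqrtr// expr_div_n q2 /sigma2.
  have -> : n%:R * r / M ^+ 2 = n%:R * (M^-1 * (1 - (2 * m%:R - 1) / M)).
    by rewrite /r; field; exact: lt0r_neq0.
  rewrite ler_wpM2l ?(ltW n_gt0)// lerDl; apply: mulr_ge0 => //.
  by apply: sumr_ge0 => j _; rewrite divr_ge0.
have sg_gt0 i : 0 < sg i by apply: lt_le_trans (sg_ge i); rewrite divr_gt0.
pose a i := t 0 i / sg i; pose A := \sum_i a i.
have a_ge0 i : 0 <= a i by rewrite divr_ge0// ltW.
have A_gt0 : 0 < A.
  rewrite lt0r sumr_ge0// andbT; apply: contra N_neq0.
  rewrite psumr_eq0// => /allP a0; rewrite -sqrf_eq0 N2 big1// => i _.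
  have /implyP/(_ isT) := a0 i (mem_index_enum i).
  by rewrite mulf_eq0 invr_eq0 (gt_eqF (sg_gt0 i)) orbF => /eqP ->; rewrite expr0n.
have A_le : A <= Num.sqrt k%:R * N * (M / q).
  apply: (@le_trans _ _ ((\sum_i t 0 i) * (M / q))).
    rewrite mulr_suml ler_sum// => i _; rewrite ler_wpM2l//.
    by rewrite -invf_div lef_pV2 ?posrE ?divr_gt0.
  rewrite ler_wpM2r ?divr_ge0 ?(ltW M_gt0) ?(ltW q_gt0)//.
  rewrite -ler_sqr ?nnegrE ?sumr_ge0 ?mulr_ge0 ?sqrtr_ge0//.
  by rewrite exprMn sqr_sqrtr ?ler0n// N2; exact: sqr_sum_le.
pose mu := n%:R / M * A; pose D := (2 * m - 1)%:R * A.
have mu_gt0 : 0 < mu by rewrite mulr_gt0// divr_gt0.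
have D_gt0 : 0 < D by rewrite mulr_gt0// bE.
pose Y := @weighted_count R m n k tau a.
have sumE p : \sum_i t 0 i * Z p 0 i = Y p - mu.
  rewrite /Y /weighted_count /mu /A mulr_sumr -sumrB; apply: eq_bigr => i _.
  by rewrite /a /sg /M !mxE; ring.
have K1_gt0 : 0 < K1 R m k.
  by rewrite /K1 -/b -/M -/r divr_gt0 ?mulr_gt0.
have K2_ge0 : 0 <= K2 R n m k.
  by rewrite /K2 -/b -/M -/r -/q divr_ge0 ?mulr_ge0 ?sqrtr_ge0
    ?(ltW b_gt0) ?(ltW M_gt0) ?(ltW q_gt0).
(* Inserting the bound [A_le] for [A] turns [D] into exactly [2 * K2 * N], and below it turns
   [2 * mu * D] into exactly [K1 * N^2]. *)
have D_le : D <= 2 * (K2 R n m k * N).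
  rewrite /D bE; apply: le_trans (ler_wpM2l (ltW b_gt0) A_le) _.
  rewrite /K2 -/b -/M -/r -/q le_eqVlt; apply/orP; left; apply/eqP; field.
  exact: lt0r_neq0.
have muD_le : 2 * (mu * D) <= K1 R m k * N ^+ 2.
  have A2_le : A ^+ 2 <= (Num.sqrt k%:R * N * (M / q)) ^+ 2.
    by rewrite ler_sqr ?nnegrE ?(le_trans (ltW A_gt0) A_le) ?(ltW A_gt0).
  have -> : 2 * (mu * D) = 2 * n%:R * b / M * A ^+ 2.
    by rewrite /mu /D bE; field; exact: lt0r_neq0.
  have c_ge0 : 0 <= 2 * n%:R * b / M.
    by rewrite divr_ge0 ?mulr_ge0 ?(ltW b_gt0) ?(ltW M_gt0).
  apply: le_trans (ler_wpM2l c_ge0 A2_le) _.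
  rewrite 2!exprMn sqr_sqrtr ?ler0n// expr_div_n q2 /K1 -/b -/M -/r.
  rewrite le_eqVlt; apply/orP; left; apply/eqP; field.
  by rewrite !lt0r_neq0.
have N2_gt0 : 0 < N ^+ 2 by rewrite exprn_gt0.
have muD_gt0 : 0 < mu * D by rewrite mulr_gt0.
have K2N_ge0 : 0 <= K2 R n m k * N by rewrite mulr_ge0.
(* The scalar deviation is [N^2], so the scalar tails have exponent [- N^4 / B]; bounding [B] by
   [K * N^2] brings it to the form [- N^2 / K]. *)
have tail_le B K : 0 < B -> 0 < K -> B <= K * N ^+ 2 ->
    N ^+ 2 / K <= (N ^+ 2) ^+ 2 / B.
  move=> B_gt0 K_gt0 BK; rewrite ler_pdivlMr// mulrAC ler_pdivrMr//.
  by rewrite [(N ^+ 2) ^+ 2]expr2 -[leRHS]mulrA ler_pM2l// mulrC.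
have cardT : #|'S_n| = n`! by exact: card_Sn.
split.
  apply: (uniform_perm_le (E := fun p => coord_le (Z p) (- t))
    (A := [pred p | Y p - mu <= - N ^+ 2]) hX).
    move=> p le_p; rewrite /= -sumE N2 -sumrN; apply: ler_sum => i _.
    by have := le_p i; rewrite [(- t) 0 i]mxE expr2 -mulrN => /ler_wpM2l; apply.
  rewrite -cardT.
  apply: le_trans (size_bias_lower_tail mu_gt0 D_gt0 _ _ (sqr_ge0 N)) _.
  - exact: weighted_count_bias_up.
  - exact: weighted_count_bias_down.
  rewrite ler_wpM2l// ler_expR lerN2; apply: tail_le.
  - exact: mulr_gt0.
  - exact: mulr_gt0.
  have := mulr_gt0 K1_gt0 N2_gt0; lra.
apply: (uniform_perm_le (E := fun p => coord_le t (Z p))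
  (A := [pred p | N ^+ 2 <= Y p - mu]) hX).
  move=> p le_p; rewrite /= -sumE N2; apply: ler_sum => i _.
  by rewrite expr2 ler_wpM2l.
rewrite -cardT.
apply: le_trans (size_bias_upper_tail mu_gt0 D_gt0 _ _ (sqr_ge0 N)) _.
- exact: weighted_count_bias_up.
- exact: weighted_count_bias_down.
have DN2_gt0 : 0 < D * N ^+ 2 by rewrite mulr_gt0.
rewrite ler_wpM2l// ler_expR lerN2; apply: tail_le.
- by rewrite addr_gt0// mulr_gt0.
- by rewrite mulr_gt0// ltr_wpDr.
(* Here [B = 2 * mu * D + D * N^2] is at most [(K1 + 2 * K2 * N) * N^2]. *)
have := ler_wpM2r (ltW N2_gt0) D_le; have := mulr_gt0 K1_gt0 N2_gt0; lra.
Qed.
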